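(* Let $G$ be a connected $d$-regular graph on $n$ vertices (bins) with conductance $\Phi(G)>0$. Consider the graphical allocation process on $G$ without batching (batch size $b=1$), where ball weights are drawn independently from a distribution $W$ on $[0,\infty)$ with $\mathbb{E}[W]=1$ and $\mathbb{E}[e^{\lambda W}]<\infty$ for a constant $\lambda>0$. Then there is a constant $k:=k(\lambda)>0$ such that for any $m\ge0$, \[ \Pr\Big[\max_{i\in[n]}|y_i^m|\le k\cdot\frac{d}{\Phi(G)}\cdot\log n\Big]\ge1-n^{-2}. \]
   Context: Graphical allocation: bins are the vertices of $G$, all initially empty. At each step $t\ge0$, an edge $\{i_1,i_2\}$ of $G$ is sampled uniformly at random, and a ball with weight sampled from $W$ is placed in the endpoint with the smaller current load (ties broken randomly). With $x_i^m$ the load of bin $i$ after $m$ balls and $W^m$ the total weight, $y^m$ denotes $(x_i^m-W^m/n)_i$ sorted decreasingly. Conductance: $\Phi(G)=\min_{S\subseteq V,\,1\le|S|\le n/2}\frac{|E(S,V\setminus S)|}{|S|\cdot d}$.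
   Formalization: The constant k is taken to depend on λ and on an upper bound M for E[e^{λW}] (uniformly in W, n, d, G, m), since a k depending on λ alone fails, e.g. for n=2 and W=1/ε with probability ε, else 0. *)

(* Defs.v *)
From HB Require Export structures.
From mathcomp Require Export all_boot all_order all_algebra.
From mathcomp Require Export all_classical all_reals all_analysis.

Set Implicit Arguments.
Unset Strict Implicit.
Unset Printing Implicit Defensive.

Import Order.TTheory GRing.Theory Num.Theory.
Import numFieldNormedType.Exports.

Local Open Scope classical_set_scope.
Local Open Scope ring_scope.

Section Graphs.
Variable n : nat.
Implicit Type g : rel 'I_n.

Definition simple_graph g : Prop := symmetric g /\ irreflexive g.

Definition connected_graph g : Prop := forall u v, connect g u v.

Definition regular_graph (d : nat) g : Prop :=
  forall u, #|[set v | g u v]%SET| = d.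

(* The undirected edge {i, j} is represented once, by the pair with i < j. *)
Definition edges g : {set 'I_n * 'I_n} :=
  [set e : 'I_n * 'I_n | (e.1 < e.2)%N && g e.1 e.2]%SET.

Definition boundary g (S : {set 'I_n}) : {set 'I_n * 'I_n} :=
  [set e in edges g | (e.1 \in S) (+) (e.2 \in S)]%SET.

(* The range of S is finite, so for n >= 2 this infimum is a minimum; for
   n <= 1 no S qualifies and the value is inf set0 = 0. *)
Definition conductance (R : realType) (d : nat) g : R :=
  inf [set #|boundary g S|%:R / (#|S| * d)%:R
        | S in [set S : {set 'I_n} | (1 <= #|S|)%N /\ (#|S|.*2 <= n)%N]].

End Graphs.

(* One trajectory of the process, as a function of the sampled edges e, the
   tie-breaking coins c and the weights w. *)
Section Trajectory.
Variables (R : realType) (n : nat).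
Variables (e : nat -> 'I_n * 'I_n) (c : nat -> bool) (w : nat -> R).

Definition chosen_bin (x : 'I_n -> R) (t : nat) : 'I_n :=
  let: (i, j) := e t in
  if x i < x j then i else if x j < x i then j else if c t then i else j.

Fixpoint load (m : nat) : 'I_n -> R :=
  if m is t.+1 then
    fun i => load t i + (if i == chosen_bin (load t) t then w t else 0)
  else fun=> 0.

Definition total_weight (m : nat) : R := \sum_(t < m) w t.

Definition sorted_normalized_load (m : nat) : seq R :=
  sort >=%R [seq load m i - total_weight m / n%:R | i <- enum 'I_n].

End Trajectory.

Definition mutually_independent (R : realType) (d : measure_display)
    (T : measurableType d) (P : probability T R) (I : eqType)
    (F : I -> set (set T)) : Prop :=
  forall (s : seq I) (A : I -> set T), uniq s ->
    (forall i, i \in s -> F i (A i)) ->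
    P (\bigcap_(i in [set` s]) A i) = (\prod_(i <- s) P (A i))%E.

Section Sampling.
Variables (R : realType) (d : measure_display) (T : measurableType d).
Variables (P : probability T R) (n : nat) (g : rel 'I_n).
Variable W : probability R R.
Variables (e : nat -> T -> 'I_n * 'I_n) (c : nat -> {RV P >-> bool})
  (w : nat -> {RV P >-> R}).

Definition sample_events (i : nat + nat + nat) : set (set T) :=
  match i with
  | inl (inl t) => preimage_set_system setT (e t) setT
  | inl (inr t) => preimage_set_system setT (c t) measurable
  | inr t => preimage_set_system setT (w t) measurable
  end.

Record allocation_samples : Prop := AllocationSamples {
  edge_measurable : forall t a, measurable (e t @^-1` [set a]) ;
  edge_uniform : forall t a,
    P (e t @^-1` [set a]) = ((a \in edges g)%:R / #|edges g|%:R)%:E ;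
  tie_fair : forall t, P (c t @^-1` [set true]) = (2^-1)%:E ;
  weight_law : forall t (B : set R),
    measurable B -> distribution P (w t) B = W B ;
  samples_independent : mutually_independent P sample_events }.

End Sampling.

(* Main.v *)
(** With [alpha] proportional to the conductance [phi], consider the hyperbolic
    cosine potential [G = \sum_i (e^u_i + e^-u_i)], where [u_i] is [alpha] times
    the normalized load of bin [i].  Averaged over the sampled edge, the
    first-order drift of [G] is exactly
      [- alpha / (n d) * \sum_{ij in E} (|e^u_i - e^u_j| + |e^-u_i - e^-u_j|)],
    because the ball goes to the smaller endpoint.  The co-area formula, applied
    to the parts of [e^u] and [e^-u] above their values at a median of [u],
    bounds this edge variation below by [phi d (G / 4 - 2 n)].  As the moment
    generating function of the weights is [1 + theta + O(theta^2)], the drift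
    dominates the second-order terms, hence [E G <= 16 n] at all times, and
    Markov's inequality at level [16 n^3] gives the claim. *)

Require Import Defs.
From mathcomp Require Import measurable_realfun.
From mathcomp Require Import ring lra zify.

Set Implicit Arguments.
Unset Strict Implicit.
Unset Printing Implicit Defensive.

Import Order.TTheory GRing.Theory Num.Theory.
Import numFieldNormedType.Exports.

Local Open Scope classical_set_scope.
Local Open Scope ring_scope.

(** * Edge variation and conductance *)

Section Conductance.
Variables (R : realType) (n d : nat) (g : rel 'I_n).
Hypotheses (g_simple : simple_graph g) (g_regular : regular_graph d g).
Implicit Types (a h u : 'I_n -> R) (S : {set 'I_n}).

(** Double counting: each vertex lies on exactly [d] edges, so each [a i] occurs [d] times. *)
Lemma sum_edges_endpoints a :
  \sum_(p in edges g) (a p.1 + a p.2) = d%:R * \sum_i a i.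
Proof.
have [gsym girr] := g_simple.
rewrite big_split /=.
pose sw (p : 'I_n * 'I_n) := (p.2, p.1).
(* Swapping coordinates makes the second endpoints first endpoints of decreasing pairs, so the two
   sums together run over all ordered adjacent pairs. *)
rewrite [X in _ + X](reindex_inj (inv_inj (f := sw) _)) => [|[]//] /=.
have -> : \sum_(p in edges g) a p.1 + \sum_(j | sw j \in edges g) a j.1 =
    \sum_(p | g p.1 p.2) a p.1.
  rewrite [RHS](bigID (fun p : 'I_n * 'I_n => (p.1 < p.2)%N)) /=.
  congr (_ + _); apply: eq_bigl => -[i j]; rewrite inE /= andbC //.
  rewrite gsym -leqNgt; case: (ltngtP j i) => //= /ord_inj ->.
  by rewrite girr.
rewrite (eq_bigr (fun p => (fun i _ => a i) p.1 p.2)) //.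
rewrite -(pair_big_dep xpredT g (fun i _ => a i)) /= mulr_sumr.
apply: eq_bigr => i _; rewrite big_const iter_addr_0 -(g_regular i) cardsE.
by rewrite mulr_natl.
Qed.

Lemma card_edges : (2 * #|edges g|)%:R = n%:R * d%:R :> R.
Proof.
have := sum_edges_endpoints (fun=> 1).
rewrite !sumr_const card_ord => H.
by rewrite natrM mulr_natr [RHS]mulrC -H.
Qed.

(** * Isoperimetry and the co-area formula *)

Let phi : R := conductance R d g.

Lemma conductance_le S : (0 < #|S|)%N -> (#|S|.*2 <= n)%N ->
  phi <= #|boundary g S|%:R / (#|S| * d)%:R.
Proof.
move=> S0 Sn; apply: ge_inf; last by exists S.
by exists 0 => _ [S' _ <-]; rewrite divr_ge0.
Qed.

Hypothesis phi_gt0 : 0 < phi.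

(** For [n <= 1] no set is admissible, and the infimum of the empty set is 0 by convention. *)
Lemma conductance_gt0_n : (1 < n)%N.
Proof.
have := phi_gt0; rewrite /phi /conductance.
set A := (X in inf X); move=> H; case: (ltnP 1 n) => // n1.
suff A0 : A = set0 by move: H; rewrite A0 inf0 ltxx.
rewrite -subset0 => x [S [S0 Sn] _].
by move: (leq_trans Sn n1); rewrite -muln2; case: #|S| S0.
Qed.

Let i0 : 'I_n := Ordinal (ltnW conductance_gt0_n).

(** For [d = 0] the ratio of a singleton is a division by zero, which returns 0. *)
Lemma conductance_gt0_d : (0 < d)%N.
Proof.
rewrite lt0n; apply/eqP => d0.
have := @conductance_le [set i0]%SET; rewrite cards1 => /(_ isT conductance_gt0_n).
by rewrite d0 muln0 invr0 mulr0 leNgt phi_gt0.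
Qed.

Lemma isoperimetry S : (#|S|.*2 <= n)%N ->
  phi * d%:R * #|S|%:R <= #|boundary g S|%:R.
Proof.
move=> Sn; have [->|S0] := posnP #|S|; first by rewrite mulr0.
have := conductance_le S0 Sn; rewrite ler_pdivlMr; last first.
  by rewrite ltr0n muln_gt0 S0 conductance_gt0_d.
by rewrite natrM [#|S|%:R * _]mulrC mulrA.
Qed.

(** A singleton is cut off by at most [d] edges, so its ratio is at most 1. *)
Lemma conductance_le1 : phi <= 1.
Proof.
apply: (le_trans (@conductance_le [set i0]%SET _ _)); rewrite cards1 //.
  exact: conductance_gt0_n.
rewrite mul1n ler_pdivrMr ?ltr0n ?conductance_gt0_d// mul1r ler_nat.
have [gsym girr] := g_simple.
rewrite -(g_regular i0).
(* [f] sends a boundary edge of the singleton to its endpoint other than [i0]; this is an injection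
   into the neighbours of [i0]. *)
pose f (p : 'I_n * 'I_n) := if p.1 == i0 then p.2 else p.1.
rewrite -(card_in_imset (f := f)).
  apply: subset_leq_card; apply/fintype.subsetP => x /imsetP[[i j] ijS ->{x}].
  move: ijS; rewrite !inE /= /f /= => /andP[/andP[ij gij] H].
  case: (eqVneq i i0) H gij => [-> //|_ /= /eqP ->]; by rewrite gsym.
move=> [i j] [i' j']; rewrite !inE /f /=.
move=> /andP[/andP[ij gij] H] /andP[/andP[ij' gij'] H'].
case: (eqVneq i i0) H ij => [->|ne] /= H ij;
  case: (eqVneq i' i0) H' ij' => [->|ne'] /= H' ij'.
- by move=> ->.
- by move/eqP: H' ij' ij => -> ij' ij jj; move: ij'; rewrite -jj; case: ltngtP ij.
- by move/eqP: H ij' ij => -> ij' ij jj; move: ij'; rewrite -jj; case: ltngtP ij.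
- by move/eqP: H => ->; move/eqP: H' => -> ->.
Qed.

(* The discrete co-area formula: peel off the lowest level set of [h]. *)
Lemma coarea h : (forall i, 0 <= h i) ->
  (#|[set i | (0 < h i)%R]%SET|.*2 <= n)%N ->
  phi * d%:R * \sum_i h i <= \sum_(p in edges g) `|h p.1 - h p.2|.
Proof.
have [k] := ubnP #|[set i | (0 < h i)%R]%SET|.
elim: k h => // k IH h.
set S := [set i | (0 < h i)%R]%SET => Sk h0 Sn.
have [S0|[i iS]] := set_0Vmem S.
  rewrite big1 ?mulr0 ?sumr_ge0// => i _; apply/eqP; rewrite eq_le h0 andbT leNgt.
  by apply/negP => hi; have : i \in S; [rewrite inE|rewrite S0 inE].
(* Lowering [h] on its support by its least positive value removes at least [m] from the support, so
   the induction on the support size applies. *)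
case: (arg_minP (P := fun i => i \in S) h iS) => m mS hm.
set delta := h m; have delta0 : 0 < delta by move: mS; rewrite inE.
pose h' j := if j \in S then h j - delta else 0.
have h'0 j : 0 <= h' j.
  by rewrite /h'; case: ifP => // jS; rewrite subr_ge0 hm.
have hE j : h j = h' j + (j \in S)%:R * delta.
  rewrite /h'; case: ifPn => jS; first by rewrite mul1r subrK.
  rewrite mul0r addr0; apply/eqP; rewrite eq_le h0 andbT leNgt.
  by move: jS; rewrite inE.
have S'S : [set j | (0 < h' j)%R]%SET \proper S.
  apply/properP; split.
    by apply/fintype.subsetP => j; rewrite inE /h'; case: ifP; rewrite ?ltxx.
  by exists m => //; rewrite inE /h' mS subrr ltxx.
have S'c := proper_card S'S.
have := IH h' (leq_trans S'c Sk) h'0.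
rewrite (leq_trans _ Sn) ?leq_double ?(ltnW S'c)// => /(_ isT) IHh.
have -> : \sum_i h i = \sum_i h' i + #|S|%:R * delta.
  rewrite (eq_bigr _ (fun j _ => hE j)) big_split /= -mulr_suml.
  rewrite -natr_sum -sum1_card; congr (_ + _%:R * _).
  by rewrite [RHS]big_mkcond; apply: eq_bigr => j _; case: (j \in S).
(* Since [h] and [h'] vanish off [S], a cut edge loses exactly [delta] and every other edge keeps
   its variation. Isoperimetry for [S] then pays for the removed layer. *)
have -> : \sum_(p in edges g) `|h p.1 - h p.2| =
    \sum_(p in edges g) `|h' p.1 - h' p.2| + #|boundary g S|%:R * delta.
  have -> : #|boundary g S| = (\sum_(p in edges g) ((p.1 \in S) (+) (p.2 \in S)))%N.
    by rewrite -sum1_card big_mkcond [RHS]big_mkcond; apply: eq_bigr => p _;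
       rewrite inE; case: (p \in edges g) => //=; case: addb.
  rewrite natr_sum mulr_suml -big_split /=; apply: eq_bigr => p _.
  have := h'0 p.1; have := h'0 p.2; rewrite (hE p.1) (hE p.2) /h'.
  case: (p.1 \in S); case: (p.2 \in S) => /= q1 q2.
  - by rewrite !mul1r mul0r addr0; congr (`| _ |); ring.
  - by rewrite !ger0_norm; lra.
  - by rewrite !ler0_norm; lra.
  - by rewrite !mul0r !addr0.
rewrite !mulrDr mulrA lerD// ler_wpM2r ?(ltW delta0)//.
exact: isoperimetry.
Qed.


(** The median is the least value [u i] that has at most half of the vertices strictly above it. *)
Lemma median u : exists mu,
  (#|[set i | (mu < u i)%R]%SET|.*2 <= n)%N /\
  (#|[set i | (u i < mu)%R]%SET|.*2 <= n)%N.
Proof.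
pose P i := (#|[set j | (u i < u j)%R]%SET|.*2 <= n)%N.
have [i1 Pi1] : exists i, P i.
  case: (@arg_maxP _ _ _ i0 xpredT u isT) => i _ Hi.
  exists i; rewrite /P (_ : [set j | (u i < u j)%R]%SET = finset.set0) ?cards0//.
  by apply/setP => j; rewrite !inE; apply/negbTE; rewrite -leNgt; apply: Hi.
case: (@arg_minP _ _ _ i1 P u Pi1) => i Pi Hi.
exists (u i); split => //.
have [->|[j0 j0S]] := set_0Vmem [set j | (u j < u i)%R]%SET; first by rewrite cards0.
have {}j0S : u j0 < u i by move: j0S; rewrite inE.
(* [u j] is the next value below [u i]. By minimality of [u i], more than half of the vertices lie
   above [u j], and the remaining ones are exactly those below [u i]. *)
case: (@arg_maxP _ _ _ j0 (fun j => u j < u i) u j0S) => j jS Hj.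
have : ~~ P j by apply/negP => /Hi /=; rewrite leNgt jS.
rewrite /P -ltnNge => Pj.
have <- : (~: [set k | (u j < u k)%R] = [set k | (u k < u i)%R])%SET.
  apply/setP => k; rewrite !inE -leNgt; apply/idP/idP => [/le_lt_trans->//|kS].
  exact: Hj.
by have := cardsC [set k | (u j < u k)%R]%SET; rewrite card_ord; lia.
Qed.

(* The tangent to [expR] at [mu] handles [1 <= mu]; otherwise [expR mu <= 4]. *)
Lemma median_exp_bound u mu : \sum_i u i = 0 -> 0 <= mu ->
  (#|[set i | (u i < mu)%R]%SET|.*2 <= n)%N ->
  n%:R * expR mu <= 2 * \sum_i expR (- u i) + 4 * n%:R.
Proof.
move=> u0 mu0; set B := [set i | _]%SET => Bn.
have E0 : 0 <= \sum_i expR (- u i) by apply: sumr_ge0 => i _; apply: expR_ge0.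
have [mu1|mu1] := leP mu 1.
  suff : n%:R * expR mu <= 4 * n%:R by lra.
  rewrite mulrC ler_wpM2r// (le_trans (_ : _ <= expR 1)) ?ler_expR//.
  (* From [expR (- (1 / 2)) >= 1 / 2] follows [expR (1 / 2) <= 2], and squaring gives
     [expR 1 <= 4]. *)
  have : expR (1 / 2) * expR (- (1 / 2)) = 1 :> R by exact: expRxMexpNx_1.
  have := expR_ge1Dx (- (1 / 2) : R); have := expR_gt0 (1 / 2 : R).
  have -> : expR 1 = expR (1 / 2) * expR (1 / 2) :> R.
    by rewrite -expRD; congr expR; lra.
  by nra.
have k1 : #|B|%:R * 2 <= n%:R :> R by rewrite -natrM ler_nat muln2.
have kE : #|~: B|%:R = n%:R - #|B|%:R :> R.
  have /(congr1 (fun k => k%:R : R)) := cardsC B.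
  by rewrite card_ord natrD => <-; rewrite addrC addKr.
have : \sum_(i in B) expR mu * (1 - u i - mu) <= \sum_i expR (- u i).
  rewrite [leRHS](bigID (mem B)) /= -[leLHS]addr0 lerD//; last first.
    by apply: sumr_ge0 => i _; apply: expR_ge0.
  apply: ler_sum => i _.
  have -> : - u i = mu + (- u i - mu) by ring.
  by rewrite expRD ler_wpM2l ?expR_ge0//; have := expR_ge1Dx (- u i - mu); lra.
rewrite -mulr_sumr => H.
(* By the zero sum, the values at least [mu] outside [B] force
   [- \sum_(i in B) u i >= (n - #|B|) * mu]. The sum is thus at least [#|B| + (n - 2 * #|B|) * mu],
   which is at least [n - #|B|] because [mu >= 1]. *)
have H2 : n%:R / 2 <= \sum_(i in B) (1 - u i - mu).
  have -> : \sum_(i in B) (1 - u i - mu) = #|B|%:R * (1 - mu) - \sum_(i in B) u i.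
    rewrite (eq_bigr (fun i => (1 - mu) - u i)) => [|i _]; last by ring.
    by rewrite big_split /= sumrN sumr_const mulr_natl.
  have : #|~: B|%:R * mu <= - \sum_(i in B) u i.
    move: u0; rewrite (bigID (mem B)) /= => /eqP; rewrite addr_eq0 => /eqP ->.
    rewrite opprK mulr_natl -sumr_const big_mkcond [leRHS]big_mkcond /=.
    apply: ler_sum => i _; rewrite finset.in_setC.
    by case: ifP => //; rewrite inE -leNgt.
  have : 0 <= (n%:R - #|B|%:R * 2) * (mu - 1) by rewrite mulr_ge0; lra.
  rewrite kE; lra.
have : expR mu * (n%:R / 2) <= expR mu * \sum_(i in B) (1 - u i - mu).
  by rewrite ler_wpM2l ?expR_ge0.
have : 0 <= n%:R :> R by [].
lra.
Qed.

(** The co-area formula is applied to the part of [expR u] above [expR mu], supported on at most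
    half of the vertices. Truncation is 1-Lipschitz, so it does not increase the variation. *)
Lemma sum_edges_dist_ge u mu : (#|[set i | (mu < u i)%R]%SET|.*2 <= n)%N ->
  phi * d%:R * (\sum_i expR (u i) - n%:R * expR mu) <=
  \sum_(p in edges g) `|expR (u p.1) - expR (u p.2)|.
Proof.
move=> un; pose h i := Num.max 0 (expR (u i) - expR mu).
have h0 i : 0 <= h i by rewrite le_max lexx.
have hS : [set i | (0 < h i)%R]%SET = [set i | (mu < u i)%R]%SET.
  by apply/setP => i; rewrite !inE lt_max ltxx subr_gt0 ltr_expR.
apply: le_trans (le_trans (@coarea h h0 _) _); last 2 first.
- by rewrite hS.
- apply: ler_sum => p _; rewrite /h.
  have [H1|H1] := leP 0 (expR (u p.1) - expR mu);
    have [H2|H2] := leP 0 (expR (u p.2) - expR mu).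
  + by rewrite opprB addrA subrK.
  + by rewrite subr0 !ger0_norm; lra.
  + by rewrite sub0r normrN ger0_norm// ler0_norm; lra.
  + by rewrite subrr normr0.
rewrite ler_wpM2l ?mulr_ge0 ?(ltW phi_gt0)//.
have -> : n%:R * expR mu = \sum_(i < n) expR mu.
  by rewrite sumr_const card_ord mulr_natl.
rewrite -sumrB.
by apply: ler_sum => i _; rewrite le_max lexx orbT.
Qed.

(** * The hyperbolic cosine potential and its drift averaged over the edges *)

Definition cosh_potential u := \sum_i (expR (u i) + expR (- u i)).

Lemma cosh_potentialE u :
  cosh_potential u = \sum_i expR (u i) + \sum_i expR (- u i).
Proof. exact: big_split. Qed.

Lemma cosh_potentialN u : cosh_potential (fun i => - u i) = cosh_potential u.
Proof. by apply: eq_bigr => i _; rewrite opprK addrC. Qed.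

Definition exp_variation u := \sum_(p in edges g)
  (`|expR (u p.1) - expR (u p.2)| + `|expR (- u p.1) - expR (- u p.2)|).

Lemma exp_variationN u : exp_variation (fun i => - u i) = exp_variation u.
Proof. by apply: eq_bigr => p _; rewrite !opprK addrC. Qed.

(* Where a positive median makes the bound on [\sum_i expR (u i)] useless, the
   zero-sum condition makes [\sum_i expR (- u i)] dominate. *)
Lemma exp_variation_ge u : \sum_i u i = 0 ->
  phi * d%:R * (cosh_potential u / 4 - 2 * n%:R) <= exp_variation u.
Proof.
have [mu [gt_mu lt_mu]] := median u.
(* Negating [u] negates the median, exchanges the two tail conditions and preserves both the
   potential and the variation. *)
wlog mu0 : u mu gt_mu lt_mu / 0 <= mu => [wlg u0|u0].
  have [mu0|mu0] := leP 0 mu; first exact: (wlg u mu).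
  rewrite -cosh_potentialN -exp_variationN; apply: (wlg _ (- mu)).
  - by under eq_finset do rewrite ltrN2.
  - by under eq_finset do rewrite ltrN2.
  - by rewrite oppr_ge0 ltW.
  - by rewrite sumrN u0 oppr0.
have := median_exp_bound u0 mu0 lt_mu.
have := sum_edges_dist_ge gt_mu.
have := @sum_edges_dist_ge (fun i => - u i) (- mu).
under eq_finset do rewrite ltrN2.
move=> /(_ lt_mu).
rewrite /exp_variation big_split /= cosh_potentialE.
set A := \sum_i expR (u i); set B := \sum_i expR (- u i).
set D1 := \sum_(p in _) _; set D2 := \sum_(p in _) _.
move=> H2 H1 H.
have D2_ge0 : 0 <= D2 by apply: sumr_ge0.
have emu : expR (- mu) <= 1 by rewrite expR_le1 oppr_le0.
have c0 : 0 <= phi * d%:R by rewrite mulr_ge0// ltW.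
have n0 : 0 <= n%:R :> R by [].
set c := phi * d%:R in c0 H1 H2 *.
have : c * (n%:R * expR mu) <= c * (2 * B + 4 * n%:R) by exact: ler_wpM2l.
have : c * (n%:R * expR (- mu)) <= c * n%:R.
  by rewrite ler_wpM2l// -[leRHS]mulr1 ler_wpM2l.
have D1_ge0 : 0 <= D1 by apply: sumr_ge0.
have : 0 <= c * B by apply: mulr_ge0 => //; apply: sumr_ge0 => i _; exact: expR_ge0.
(* The combination is [D1 / 4 + D2]: the loss [c * B / 2] caused by [expR mu] is absorbed by the
   [c * B] from [D2], and the constant terms add up to [2 * n]. *)
lra.
Qed.

(** The first-order part is exact. For the second, [0 <= n%:R^-1 <= 1] gives [((l == b)%:R -
    n%:R^-1) ^+ 2 <= (l == b)%:R + n%:R^-1]. *)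
Lemma weighted_step_le (v : 'I_n -> R) (alpha K : R) (b : 'I_n) :
  (forall l, 0 <= v l) -> 0 <= K ->
  \sum_l v l * (1 + alpha * ((l == b)%:R - n%:R^-1) +
                K * (alpha * ((l == b)%:R - n%:R^-1)) ^+ 2) <=
  \sum_l v l + alpha * (v b - (\sum_l v l) / n%:R) +
  K * alpha ^+ 2 * (v b + (\sum_l v l) / n%:R).
Proof.
move=> v0 K0; set V := \sum_l v l.
have vb : v b = \sum_l v l * (l == b)%:R.
  rewrite (bigD1 b)//= eqxx mulr1 big1 ?addr0// => l /negbTE ->.
  by rewrite mulr0.
have n1 : 0 <= (n%:R^-1 : R) <= 1.
  rewrite invr_ge0 ler0n /= invf_le1 ?ltr0n ?(ltnW conductance_gt0_n)//.
  by rewrite ler1n (ltnW conductance_gt0_n).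
have -> : V + alpha * (v b - V / n%:R) + K * alpha ^+ 2 * (v b + V / n%:R) =
    \sum_l v l * (1 + alpha * ((l == b)%:R - n%:R^-1) +
                  K * alpha ^+ 2 * ((l == b)%:R + n%:R^-1)).
  rewrite vb /V !mulr_suml -sumrB -big_split /= !mulr_sumr -!big_split /=.
  by apply: eq_bigr => l _; ring.
apply: ler_sum => l _; apply: ler_wpM2l => //.
rewrite lerD2l exprMn mulrA; apply: ler_wpM2l; first by rewrite mulr_ge0 ?sqr_ge0.
by rewrite expr2; move/andP: n1 => []; case: eqP => _ /=; nra.
Qed.

(** The inner sum is the bound on the potential left after integrating out the weight, with the ball
    in the endpoint [b p] of smaller load. Half of the first-order drift is spent on the quadratic
    terms. *)
Lemma expected_step_le u (alpha K : R) (b : 'I_n * 'I_n -> 'I_n) :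
  \sum_i u i = 0 -> 0 <= alpha -> 0 <= K -> 3 * K * alpha <= phi / 8 ->
  (forall p, b p = p.1 \/ b p = p.2) ->
  (forall p, u (b p) <= u p.1 /\ u (b p) <= u p.2) ->
  \sum_(p in edges g) \sum_l
    (expR (u l) * (1 + alpha * ((l == b p)%:R - n%:R^-1) +
       K * (alpha * ((l == b p)%:R - n%:R^-1)) ^+ 2) +
     expR (- u l) * (1 + - alpha * ((l == b p)%:R - n%:R^-1) +
       K * (- alpha * ((l == b p)%:R - n%:R^-1)) ^+ 2)) <=
  #|edges g|%:R * ((1 - alpha * phi / (8 * n%:R)) * cosh_potential u +
    2 * alpha * phi).
Proof.
move=> u0 alpha0 K0 Kalpha b12 bmin.
set A := \sum_i expR (u i); set B := \sum_i expR (- u i).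
have GE : cosh_potential u = A + B by exact: cosh_potentialE.
have n_gt0 : 0 < n%:R :> R by rewrite ltr0n (ltnW conductance_gt0_n).
pose s p := expR (u p.1) + expR (u p.2).
pose r p := expR (- u p.1) + expR (- u p.2).
pose D p := `|expR (u p.1) - expR (u p.2)| + `|expR (- u p.1) - expR (- u p.2)|.
have ss : \sum_(p in edges g) s p = d%:R * A by exact: sum_edges_endpoints.
have sr : \sum_(p in edges g) r p = d%:R * B.
  exact: (sum_edges_endpoints (fun i => expR (- u i))).
have sD : \sum_(p in edges g) D p = exp_variation u by [].
pose S p := A + B + alpha * ((s p - r p - D p) / 2 - (A - B) / n%:R) +
  K * alpha ^+ 2 * (s p + r p + (A + B) / n%:R).
have step_le p : \sum_l
    (expR (u l) * (1 + alpha * ((l == b p)%:R - n%:R^-1) +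
       K * (alpha * ((l == b p)%:R - n%:R^-1)) ^+ 2) +
     expR (- u l) * (1 + - alpha * ((l == b p)%:R - n%:R^-1) +
       K * (- alpha * ((l == b p)%:R - n%:R^-1)) ^+ 2)) <= S p.
  rewrite big_split /=.
  have H1 := @weighted_step_le (fun l => expR (u l)) alpha K (b p)
    (fun l => expR_ge0 _) K0.
  have H2 := @weighted_step_le (fun l => expR (- u l)) (- alpha) K (b p)
    (fun l => expR_ge0 _) K0.
  apply: le_trans (lerD H1 H2) _; rewrite -/A -/B sqrrN /S.
  have [m1 m2] := bmin p.
  (* At [b p] the increasing [expR u] takes the smaller of its two endpoint values and [expR (- u)]
     the larger: these are half the sum minus, respectively plus, half the distance. *)
  have E1 : expR (u (b p)) - expR (- u (b p)) = (s p - r p - D p) / 2.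
    rewrite /s /r /D; case: (b12 p) => Eb; rewrite Eb in m1 m2 *.
      rewrite ler0_norm ?subr_le0 ?ler_expR// ger0_norm ?subr_ge0 ?ler_expR ?lerN2//.
      by lra.
    rewrite ger0_norm ?subr_ge0 ?ler_expR// ler0_norm ?subr_le0 ?ler_expR ?lerN2//.
    by lra.
  have E2 : expR (u (b p)) + expR (- u (b p)) <= s p + r p.
    rewrite /s /r; have := expR_ge0 (u p.1); have := expR_ge0 (u p.2).
    have := expR_ge0 (- u p.1); have := expR_ge0 (- u p.2).
    by case: (b12 p) => ->; lra.
  have := ler_wpM2l (mulr_ge0 K0 (sqr_ge0 alpha)) E2.
  rewrite -E1; lra.
apply: le_trans (ler_sum _ (fun p _ => step_le p)) _.
have -> : \sum_(p in edges g) S p = #|edges g|%:R * (A + B)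
   + alpha * ((d%:R * A - d%:R * B - exp_variation u) / 2
       - #|edges g|%:R * ((A - B) / n%:R))
   + K * alpha ^+ 2 * (d%:R * A + d%:R * B + #|edges g|%:R * ((A + B) / n%:R)).
  (* [Q] gathers the terms that do not depend on the edge. *)
  have [Q QE] : exists Q, Q =
    A + B - alpha * ((A - B) / n%:R) + K * alpha ^+ 2 * ((A + B) / n%:R) by eexists.
  rewrite (eq_bigr (fun p => Q + (alpha / 2 + K * alpha ^+ 2) * s p
    + (K * alpha ^+ 2 - alpha / 2) * r p + (- alpha / 2) * D p)); last first.
    by move=> p _; rewrite /S QE; ring.
  rewrite !big_split /= -!mulr_sumr ss sr sD sumr_const -[Q *+ _]mulr_natl QE.
  by ring.
have ce : #|edges g|%:R = n%:R * d%:R / 2 :> R.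
  by have := card_edges; rewrite natrM; lra.
have := exp_variation_ge u0; rewrite GE ce => V.
(* As [#|edges g| / n = d / 2], the centring term cancels the endpoint sums, and only
   [exp_variation] survives at first order. *)
have En x : n%:R * d%:R / 2 * (x / n%:R) = d%:R / 2 * x :> R.
  by field; rewrite gt_eqF.
rewrite !En.
have -> : n%:R * d%:R / 2 *
      ((1 - alpha * phi / (8 * n%:R)) * (A + B) + 2 * alpha * phi) =
    n%:R * d%:R / 2 * (A + B) - d%:R * alpha * phi / 16 * (A + B) +
      n%:R * d%:R * alpha * phi.
  by field; rewrite gt_eqF.
have AB : 0 <= d%:R * alpha * (A + B).
  by rewrite !mulr_ge0// addr_ge0// sumr_ge0// => i _; exact: expR_ge0.
(* The quadratic terms total [3 / 2 * K * alpha ^+ 2 * d * (A + B)], at most half of the gain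
   [alpha * phi * d * (A + B) / 8]. *)
have := ler_wpM2l AB Kalpha; have := ler_wpM2l alpha0 V.
rewrite expr2; lra.
Qed.

End Conductance.

(** * Moment generating function of the weights *)

(** The inequality [1 - x <= expR (- x)] gives [expR x <= 1 + x * expR x]. For [x >= 0] this is used
    twice; for [x < 0] the second use is replaced by [1 + x <= expR x]. *)
Lemma expR_le_quadratic (R : realType) (x : R) :
  expR x <= 1 + x + x ^+ 2 * expR `|x|.
Proof.
have E1 := expRxMexpNx_1 x; have e0 := expR_gt0 x; have e0' := expR_gt0 (- x).
have N1 := expR_ge1Dx (- x); have P1 := expR_ge1Dx x; rewrite expr2.
have H1 : expR x * (1 - x) <= 1 by rewrite -[leRHS]E1 ler_wpM2l// ltW.
have [x0|x0] := leP 0 x.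
  have : 0 <= x * (1 - expR x * (1 - x)) by rewrite mulr_ge0// subr_ge0.
  rewrite ger0_norm//; lra.
have : 0 <= - x * (expR x - (1 + x)) by rewrite mulr_ge0//; lra.
have : 0 <= x * x * (expR (- x) - 1) by rewrite mulr_ge0 -?expr2 ?sqr_ge0//; lra.
rewrite ltr0_norm//; lra.
Qed.

Section MomentGeneratingFunction.
Variables (R : realType) (W : probability R R) (lambda M : R).
Hypothesis lambda_gt0 : 0 < lambda.

(** Half of the exponent [lambda * x] dominates the exponential of the remainder, the other half
    dominates its factor [x ^+ 2]. *)
Lemma expR_le_tilted (theta x : R) : `|theta| <= lambda / 2 -> 0 <= x ->
  expR (theta * x) <=
  1 + theta * x + 16 / lambda ^+ 2 * theta ^+ 2 * expR (lambda * x).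
Proof.
move=> theta_le x0; apply: le_trans (expR_le_quadratic _) _.
rewrite lerD2l exprMn -[leLHS]mulrA [_ / _ * _]mulrC -[leRHS]mulrA.
rewrite ler_wpM2l ?sqr_ge0//.
have ex : expR `|theta * x| <= expR (lambda * x / 2).
  by rewrite ler_expR normrM (ger0_norm x0) mulrAC ler_wpM2r.
have x2 : x ^+ 2 <= 16 / lambda ^+ 2 * expR (lambda * x / 2).
  (* Squaring [lambda * x / 4 <= expR (lambda * x / 4)] produces the constant 16. *)
  have := expR_ge1Dx (lambda * x / 4) => H.
  have l4 : 0 <= lambda * x / 4 by rewrite divr_ge0// mulr_ge0// ltW.
  have -> : lambda * x / 2 = lambda * x / 4 + lambda * x / 4 by lra.
  rewrite expRD.
  have -> : x ^+ 2 = 16 / lambda ^+ 2 * ((lambda * x / 4) * (lambda * x / 4)).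
    by field; rewrite gt_eqF.
  rewrite ler_wpM2l ?divr_ge0 ?sqr_ge0// ler_pM//; lra.
rewrite [expR (lambda * x)](_ : _ = expR (lambda * x / 2) * expR (lambda * x / 2)).
  by rewrite mulrA ler_pM ?expR_ge0 ?sqr_ge0.
by rewrite -expRD; congr expR; lra.
Qed.

Hypothesis W_ge0 : W `[0, +oo[%classic = 1%E.
Hypothesis W_mean : (\int[W]_x x%:E = 1)%E.
Hypothesis W_exp : (\int[W]_x (expR (lambda * x))%:E <= M%:E)%E.

Let D : set R := `[0, +oo[%classic.

Let mD : measurable D. Proof. exact: measurable_itv. Qed.

(** This allows pointwise bounds that hold only for nonnegative weights to be integrated. *)
Lemma integral_nonneg_support (f : R -> R) : measurable_fun setT f ->
  (\int[W]_x (f x)%:E = \int[W]_(x in D) (f x)%:E)%E.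
Proof.
move=> mf; rewrite [RHS]integral_mkcond; apply: ae_eq_integral => //.
- exact/measurable_EFinP.
- apply/(measurable_restrictT _ mD).
  apply: (measurable_funS measurableT) => //. exact/measurable_EFinP.
- exists (~` D); split.
  + exact: measurableC.
  + by have := probability_setC W mD; rewrite W_ge0 subee.
  + by move=> x /= H Dx; apply: H => _; rewrite /patch mem_set.
Qed.

Let measurable_exp_linear (a : R) : measurable_fun setT (fun x => expR (a * x)).
Proof. by apply: measurableT_comp => //; exact: measurable_funM. Qed.

(** Integrate [expR_le_tilted]: the mean 1 yields [theta], and [M] bounds the tilted term. *)
Lemma mgf_le (theta : R) : `|theta| <= lambda / 2 ->
  (\int[W]_x (expR (theta * x))%:E <=
    (1 + theta + 16 * M / lambda ^+ 2 * theta ^+ 2)%:E)%E.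
Proof.
move=> theta_le; rewrite integral_nonneg_support//.
have iexp : W.-integrable D (EFin \o (fun x => expR (lambda * x))).
  apply/integrableP; split.
    by apply/measurable_EFinP; exact: measurable_funS (measurable_exp_linear _).
  under eq_integral do rewrite /= ger0_norm ?expR_ge0//.
  by rewrite -integral_nonneg_support// (le_lt_trans W_exp)// ltry.
have ix : W.-integrable D (EFin \o id).
  apply: (@le_integrable _ _ _ W D mD _
    (fun x => (lambda^-1)%:E * (EFin \o (fun x => expR (lambda * x))) x)%E).
  - exact/measurable_EFinP.
  - move=> x; rewrite /D /= in_itv /= andbT => x0.
    have xe : x <= lambda^-1 * expR (lambda * x).
      by rewrite mulrC ler_pdivlMr// mulrC (le_trans _ (expR_ge1Dx _))// lerDr.
    by rewrite /= lee_fin !ger0_norm// (le_trans x0).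
  - exact: integrableZl.
have iK : W.-integrable D (fun x => ((16 / lambda ^+ 2 * theta ^+ 2)%:E *
     (EFin \o (fun x => expR (lambda * x))) x)%E) by exact: integrableZl.
have ith : W.-integrable D (fun x => (theta%:E * (EFin \o id) x)%E).
  exact: integrableZl.
have i1 : W.-integrable D (EFin \o cst 1) by exact: finite_measure_integrable_cst.
have i2 := integrableD mD i1 ith.
apply: (@le_trans _ _ (\int[W]_(x in D) ((EFin \o cst 1%R) x
    + theta%:E * (EFin \o id) x + (16 / lambda ^+ 2 * theta ^+ 2)%:E *
      (EFin \o (fun x => expR (lambda * x))%R) x))%E).
  apply: le_integral => //.
  - apply: (le_integrable mD _ _ (integrableD mD i2 iK)).
      by apply/measurable_EFinP; exact: measurable_funS (measurable_exp_linear _).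
    move=> x; rewrite /D /= in_itv /= andbT => x0.
    have := expR_le_tilted theta_le x0; have := expR_ge0 (theta * x) => e0 le.
    by rewrite /= lee_fin !ger0_norm// (le_trans e0).
  - exact: integrableD.
  - move=> x; rewrite inE /D /= in_itv /= andbT => x0.
    by rewrite /= lee_fin expR_le_tilted.
rewrite (integralD mD i2 iK) (integralD mD i1 ith) !integralZl//.
have -> : (\int[W]_(x in D) (EFin \o cst 1%R) x = 1)%E.
  transitivity (1 * W D)%E; first exact: (integral_cst W mD 1%E).
  by rewrite [W D]W_ge0 mule1.
rewrite -[X in (_ + theta%:E * X + _)%E](integral_nonneg_support (f := id))//.
rewrite W_mean mule1 !EFinD leeD2l//.
rewrite (_ : 16 * M / _ * _ = 16 / lambda ^+ 2 * theta ^+ 2 * M); last by ring.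
rewrite [leRHS]EFinM; apply: lee_wpmul2l.
  by rewrite lee_fin mulr_ge0 ?divr_ge0 ?sqr_ge0.
by rewrite -[leLHS](integral_nonneg_support (measurable_exp_linear _)).
Qed.

End MomentGeneratingFunction.

(** * Integration against an independent weight *)

Section IndependentIntegration.
Context (R : realType) (dT : measure_display) (T : measurableType dT).
Local Open Scope ereal_scope.

(** Turning the domain [E] into a restricted measure lets a joint law on [E] be identified as a
    measure on the whole space. *)
Lemma ge0_integral_mrestr (mu : {measure set T -> \bar R}) (E : set T)
    (mE : measurable E) (f : T -> \bar R) :
  measurable_fun setT f -> (forall x, 0 <= f x) ->
  \int[mrestr mu mE]_x f x = \int[mu]_(x in E) f x.
Proof.
move=> mf f0.
rewrite (@ge0_negligible_integral _ _ _ (mrestr mu mE) setT (~` E))//; last 2 first.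
- exact: measurableC.
- by rewrite /= /mrestr setICl measure0.
rewrite setTD setCK; apply: eq_measure_integral => A mA AE.
by rewrite /= /mrestr setIidl.
Qed.

Variables (P : probability T R) (G : set (set T)) (W : probability R R).
Variables (w : {RV P >-> R}) (E : set T).
Hypotheses (Gm : G `<=` measurable) (mE : measurable E).
Hypothesis G_indep : forall (A : set T) (B : set R), <<s G >> A -> measurable B ->
  P (A `&` (E `&` w @^-1` B)) = P A * (P E * W B).

(** [T] with the smaller sigma-algebra generated by [G]: measurability on [T'] expresses dependence
    on the history alone. *)
Let T' := g_sigma_algebraType G.

Let toG (x : T) : T' := x.

Let measurable_toG : measurable_fun setT toG.
Proof.
move=> _ A mA; rewrite setTI.
by apply: (smallest_sub (@sigma_algebra_measurable _ T) Gm).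
Qed.

Lemma measurable_fun_g_sigma d' (U : measurableType d') (f : T -> U) :
  measurable_fun setT (f : T' -> U) -> measurable_fun setT f.
Proof. by move=> mf; exact: (measurableT_comp mf measurable_toG). Qed.

Lemma measurable_fun_comp_g_sigma d' (U : measurableType d') (f : T' * R -> U) :
  measurable_fun setT f -> measurable_fun setT (fun x : T => f (x, w x)).
Proof.
move=> mf; apply: (measurableT_comp mf (g := fun x => (toG x, w x))).
exact: measurable_fun_pair.
Qed.

HB.instance Definition _ := isMeasurableFun.Build _ _ _ _ toG measurable_toG.

(** On [E], the pair of history and weight has law [P E] times a product measure, because both agree
    on rectangles by [G_indep]. Tonelli then separates the integrals. *)
Lemma independent_fubini (f : T' * R -> \bar R) :
  measurable_fun setT f -> (forall z, 0 <= f z) ->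
  \int[P]_(x in E) f (x, w x) = P E * \int[P]_x \int[W]_y f (x, y).
Proof.
move=> mf f0.
rewrite -ge0_integral_mrestr//; last exact: measurable_fun_comp_g_sigma.
pose Z (x : T) : T' * R := (toG x, w x).
have mZ : measurable_fun setT Z by exact: measurable_fun_pair.
have := @ge0_integral_pushforward _ _ _ _ _ Z mZ (mrestr P mE) setT f measurableT mf.
rewrite preimage_setT => <-//.
have PE0 : (0 <= fine (P E))%R by apply: fine_ge0.
pose m1 := mscale (NngNum PE0) (distribution P toG).
transitivity (\int[m1 \x W]_z f z).
  apply: eq_measure_integral => X mX _; apply/esym.
  apply: product_measure_unique => // A B mA mB.
  rewrite /= /pushforward /mrestr /mscale /= /distribution /pushforward.
  have -> : Z @^-1` (A `*` B) `&` E = A `&` (E `&` w @^-1` B).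
    by apply/seteqP; split => x; rewrite /Z /toG /=; tauto.
  by rewrite G_indep// fineK ?fin_num_measure// muleCA muleA.
have mF : measurable_fun setT (fubini_F W f).
  exact: measurable_fun_fubini_tonelli_F.
have F0 x : 0 <= fubini_F W f x by apply: integral_ge0.
rewrite fubini_tonelli1// ge0_integral_mscale//= fineK ?fin_num_measure//.
congr (_ * _).
have := @ge0_integral_pushforward _ _ _ _ _ toG measurable_toG P setT _ measurableT mF.
by rewrite preimage_setT => ->.
Qed.

End IndependentIntegration.

(** * The history sigma-algebra *)

Section History.
Context (R : realType) (dT : measure_display) (T : measurableType dT).
Variables (P : probability T R) (n : nat) (g : rel 'I_n) (W : probability R R).
Variables (e : nat -> T -> 'I_n * 'I_n) (c : nat -> {RV P >-> bool})
  (w : nat -> {RV P >-> R}).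
Hypothesis samples : allocation_samples g W e c w.

Local Notation events := (sample_events e c w).

Lemma sample_events_measurable i A : events i A -> measurable A.
Proof.
case: i => [[t|t]|t] /= [B BG <-].
- rewrite setTI.
  have -> : e t @^-1` B = \bigcup_(a in B) (e t @^-1` [set a]).
    by apply/seteqP; split => [x Bx|x [a Ba /= ea]]; [exists (e t x)|rewrite /= ea].
  apply: fin_bigcup_measurable => [|a _]; first exact: finite_finset.
  exact: edge_measurable samples t a.
- exact: measurable_funP.
- exact: measurable_funP.
Qed.

Lemma sample_eventsT i : events i setT.
Proof. by case: i => [[t|t]|t] /=; exists setT; rewrite ?setTI ?preimage_setT. Qed.

Lemma sample_eventsI i A B : events i A -> events i B -> events i (A `&` B).
Proof.
by case: i => [[t|t]|t] /= [C mC <-] [D mD <-]; exists (C `&` D);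
  rewrite ?setTI ?preimage_setI//; exact: measurableI.
Qed.

(* All coins count as history: the coin of step [t] is independent of the edge
   and the weight of step [t], and it is needed to determine the next bin. *)
Definition in_history (t : nat) (i : nat + nat + nat) : bool :=
  match i with
  | inl (inl s) => (s < t)%N
  | inl (inr _) => true
  | inr s => (s < t)%N
  end.

(** Finite intersections are taken so that the family is a pi-system on which the product rule for
    independent samples applies directly. *)
Definition history_events (t : nat) : set (set T) :=
  [set A | exists (s : seq (nat + nat + nat)) (F : nat + nat + nat -> set T),
    [/\ uniq s, {in s, forall i, in_history t i}, {in s, forall i, events i (F i)}
      & A = \bigcap_(i in [set` s]) F i]].

Lemma history_event t i A : in_history t i -> events i A -> history_events t A.
Proof.
move=> ti iA; exists [:: i], (fun=> A); split => //.
- by move=> j; rewrite inE => /eqP ->.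
- by move=> j; rewrite inE => /eqP ->.
- apply/seteqP; split => [x Ax j _ //|x /(_ i)].
  by apply; rewrite /= inE.
Qed.

Lemma history_eventsT t : history_events t setT.
Proof. by exists [::], (fun=> setT); split => //; apply/seteqP; split. Qed.

Lemma history_events_measurable t : history_events t `<=` measurable.
Proof.
move=> _ [s [F [_ _ sF ->]]]; apply: fin_bigcap_measurable => // i si.
exact: sample_events_measurable (sF i si).
Qed.

Lemma history_events_setI_closed t : setI_closed (history_events t).
Proof.
move=> _ _ [s1 [F1 [u1 t1 e1 ->]]] [s2 [F2 [u2 t2 e2 ->]]].
(* Events sharing an index are merged and missing ones padded by [setT], since independence is
   stated for lists without repetition. *)
pose F i := (if i \in s1 then F1 i else setT) `&` (if i \in s2 then F2 i else setT).
exists (undup (s1 ++ s2)), F; split.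
- exact: undup_uniq.
- by move=> i; rewrite mem_undup mem_cat => /orP[/t1|/t2].
- move=> i _; apply: sample_eventsI; case: ifP => [si|_].
  + exact: e1.
  + exact: sample_eventsT.
  + exact: e2.
  + exact: sample_eventsT.
- apply/seteqP; split => [x [x1 x2] i _|x xF].
    by split; case: ifP => // si; [exact: x1|exact: x2].
  split=> i /= si.
  + have [] := xF i _; last by rewrite si.
    by rewrite /= mem_undup mem_cat si.
  + have [] := xF i _; last by rewrite si.
    by rewrite /= mem_undup mem_cat si orbT.
Qed.

(** As functions of [A], both sides are finite measures that agree on the pi-system
    [history_events], hence on the sigma-algebra it generates. *)
Lemma history_independent t (a : 'I_n * 'I_n) (A : set T) (B : set R) :
  <<s history_events t >> A -> measurable B ->
  P (A `&` (e t @^-1` [set a] `&` w t @^-1` B)) =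
  (P A * (P (e t @^-1` [set a]) * W B))%E.
Proof.
move=> hA mB; set E := e t @^-1` [set a].
have mE : measurable E by exact: edge_measurable samples t a.
have mwB : measurable (w t @^-1` B).
  by rewrite -[X in measurable X]setTI; exact: measurable_funP.
have mEB : measurable (E `&` w t @^-1` B) by exact: measurableI.
have fW : W B = P (w t @^-1` B) by rewrite -(weight_law samples t mB).
have r0 : 0 <= fine (P E * W B)%E by rewrite fine_ge0// mule_ge0.
have finEB : (P E * W B)%E \is a fin_num by rewrite fin_numM// fin_num_measure.
transitivity (mscale (NngNum r0) P A); last by rewrite /mscale /= fineK// muleC.
apply: (g_sigma_algebra_measure_unique (history_events t) _ (fun=> setT)
  _ _ (mrestr P mEB) (mscale (NngNum r0) P)) => //.
- exact: history_events_measurable.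
- by move=> _; exact: history_eventsT.
- by rewrite bigcup_const.
- exact: history_events_setI_closed.
- move=> _ [s [F [us ts sF ->]]].
  rewrite /= /mrestr /mscale /= fineK//.
  (* The edge and the weight of step [t] are new indices, as [s] only holds edges and weights of
     earlier steps; [F'] is the family on the enlarged list. *)
  pose F' i := if i == inl (inl t) then E else if i == inr t then w t @^-1` B else F i.
  have nt1 : inl (inl t) \notin s by apply/negP => /ts /=; rewrite ltnn.
  have nt2 : inr t \notin s by apply/negP => /ts /=; rewrite ltnn.
  have F's i : i \in s -> F' i = F i.
    move=> si; rewrite /F'.
    by do 2 (case: eqP => [ei|_]; first by move: nt1 nt2; rewrite -ei si).
  have ind := samples_independent samples.
  rewrite (ind s F us sF).
  have -> : \bigcap_(i in [set` s]) F i `&` (E `&` w t @^-1` B) =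
      \bigcap_(i in [set` [:: inl (inl t), inr t & s]]) F' i.
    apply/seteqP; split => [x [xs [xE xB]] i|x xF'].
      rewrite /= !inE => /or3P[/eqP ->|/eqP ->|si].
      + by rewrite /F' eqxx.
      + by rewrite /F' eqxx.
      + by rewrite F's//; exact: xs.
    split=> [i si|].
      by rewrite -F's//; apply: xF'; rewrite /= !inE si !orbT.
    split.
      by have := xF' (inl (inl t)); rewrite /F' eqxx; apply; rewrite /= inE eqxx.
    by have := xF' (inr t); rewrite /F' /= eqxx; apply; rewrite /= !inE eqxx.
  rewrite (ind [:: inl (inl t), inr t & s] F').
  + rewrite !big_cons /F' !eqxx /= -fW muleA; congr (_ * _)%E.
    by rewrite big_seq [RHS]big_seq; apply: eq_bigr => i si;
       have := F's i si; rewrite /F' => ->.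
  + by rewrite /= inE negb_or nt1 nt2 us.
  + move=> i; rewrite !inE => /or3P[/eqP ->|/eqP ->|si].
    * by rewrite /F' eqxx; exists [set a]; rewrite ?setTI.
    * by rewrite /F' eqxx; exists B; rewrite ?setTI.
    * by rewrite F's//; exact: sF.
- move=> _; rewrite /= /mrestr setTI.
  by rewrite (le_lt_trans (probability_le1 _ _))// ltry.
Qed.

End History.

(** * One step of the process *)

Section PickBin.
Variables (R : realType) (n : nat).
Implicit Types (a : 'I_n * 'I_n) (x : 'I_n -> R).

(** Here the edge is an explicit argument, so that it can be held fixed while history and weight
    vary. *)
Definition pick_bin a x (b : bool) : 'I_n :=
  if x a.1 < x a.2 then a.1
  else if x a.2 < x a.1 then a.2 else if b then a.1 else a.2.

Lemma chosen_binE (e : nat -> 'I_n * 'I_n) c x t :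
  chosen_bin e c x t = pick_bin (e t) x (c t).
Proof. by rewrite /chosen_bin; case: (e t). Qed.

Lemma pick_bin_endpoint a x b : pick_bin a x b = a.1 \/ pick_bin a x b = a.2.
Proof. by rewrite /pick_bin; do 3 (case: ifP => _; auto). Qed.

Lemma pick_bin_le a x b : x (pick_bin a x b) <= x a.1 /\ x (pick_bin a x b) <= x a.2.
Proof.
by rewrite /pick_bin; case: ltgtP => [/ltW h|/ltW h|h] //; case: b; rewrite h.
Qed.

Lemma measurable_pick_bin d (U : measurableType d) (x : U -> 'I_n -> R)
    (b : U -> bool) a l :
  (forall i, measurable_fun setT (x ^~ i)) -> measurable_fun setT b ->
  measurable_fun setT (fun o => l == pick_bin a (x o) (b o)).
Proof.
move=> mx mb; rewrite (_ : (fun o => _) = fun o => if x o a.1 < x o a.2 then l == a.1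
  else if x o a.2 < x o a.1 then l == a.2 else if b o then l == a.1 else l == a.2).
  apply: measurable_fun_ifT => //; first exact: measurable_fun_ltr.
  apply: measurable_fun_ifT => //; first exact: measurable_fun_ltr.
  exact: measurable_fun_ifT.
by apply/funext => o; rewrite /pick_bin; do 3 (case: ifP => _ //).
Qed.

Lemma sum_load (e : nat -> 'I_n * 'I_n) c (w : nat -> R) t :
  \sum_i load e c w t i = total_weight w t.
Proof.
rewrite /total_weight; elim: t => [|t IH]; first by rewrite big_ord0 big1.
rewrite big_ord_recr /= big_split /= IH; congr (_ + _).
by rewrite -big_mkcond big_pred1_eq.
Qed.

Definition scaled_load (alpha : R) (e : nat -> 'I_n * 'I_n) c (w : nat -> R) t i :=
  alpha * (load e c w t i - total_weight w t / n%:R).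

Lemma sum_scaled_load alpha (e : nat -> 'I_n * 'I_n) c (w : nat -> R) t :
  (0 < n)%N -> \sum_i scaled_load alpha e c w t i = 0.
Proof.
move=> n0; rewrite -mulr_sumr sumrB sum_load sumr_const card_ord.
by rewrite -(mulr_natr (_ / _)) divfK ?pnatr_eq0 ?lt0n_neq0// subrr mulr0.
Qed.

Lemma scaled_loadS alpha (e : nat -> 'I_n * 'I_n) c (w : nat -> R) t i :
  scaled_load alpha e c w t.+1 i = scaled_load alpha e c w t i +
    alpha * ((i == pick_bin (e t) (load e c w t) (c t))%:R - n%:R^-1) * w t.
Proof.
rewrite /scaled_load /total_weight big_ord_recr /= chosen_binE.
by case: eqP => _ /=; ring.
Qed.

End PickBin.

(** * Averaging one step over the weight *)

Section OneStep.
Variables (R : realType) (W : probability R R) (lambda M : R) (n : nat).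
Hypothesis lambda_gt0 : 0 < lambda.
Hypothesis W_ge0 : W `[0, +oo[%classic = 1%E.
Hypothesis W_mean : (\int[W]_x x%:E = 1)%E.
Hypothesis W_exp : (\int[W]_x (expR (lambda * x))%:E <= M%:E)%E.
Hypothesis n_gt0 : (0 < n)%N.

Let K := 16 * M / lambda ^+ 2.

Lemma integral_exp_step_le (u theta : R) : `|theta| <= lambda / 2 ->
  (\int[W]_x (expR (u + theta * x))%:E <=
    (expR u * (1 + theta + K * theta ^+ 2))%:E)%E.
Proof.
move=> theta_le.
under eq_integral do rewrite expRD EFinM.
rewrite ge0_integralZl//.
- rewrite EFinM lee_wpmul2l ?lee_fin ?expR_ge0//.
  exact: mgf_le lambda_gt0 W_ge0 W_mean W_exp _ theta_le.
- apply/measurable_EFinP; apply: measurableT_comp => //; exact: measurable_funM.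
Qed.

Lemma integral_step_le (u : 'I_n -> R) (alpha : R) (b : 'I_n) :
  0 <= alpha <= lambda / 2 ->
  (\int[W]_x (cosh_potential (fun l =>
      u l + alpha * ((l == b)%:R - n%:R^-1) * x))%:E <=
   (\sum_l (expR (u l) * (1 + alpha * ((l == b)%:R - n%:R^-1) +
       K * (alpha * ((l == b)%:R - n%:R^-1)) ^+ 2) +
     expR (- u l) * (1 + - alpha * ((l == b)%:R - n%:R^-1) +
       K * (- alpha * ((l == b)%:R - n%:R^-1)) ^+ 2)))%:E)%E.
Proof.
move=> /andP[alpha0 alpha_le].
have mexp (v theta : R) : measurable_fun setT (fun x : R => (expR (v + theta * x))%:E).
  apply/measurable_EFinP; apply: measurableT_comp => //.
  by apply: measurable_funD => //; exact: measurable_funM.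
rewrite /cosh_potential.
under eq_integral do rewrite -sumEFin.
rewrite ge0_integral_sum//; last first.
  move=> l; under eq_fun do rewrite EFinD opprD -mulNr.
  exact: emeasurable_funD.
rewrite -sumEFin; apply: lee_sum => l _.
set q := (l == b)%:R - _.
(* Hence the factor of the weight in each exponent is at most [alpha <= lambda / 2] in absolute
   value, the range of [mgf_le]. *)
have q1 : `|q| <= 1.
  have : 0 <= (n%:R^-1 : R) <= 1.
    by rewrite invr_ge0 ler0n /= invf_le1 ?ltr0n// ler1n.
  by rewrite ler_norml /q; case: eqP => _ /=; lra.
have aq : `|alpha * q| <= lambda / 2.
  by rewrite normrM (ger0_norm alpha0) (le_trans _ alpha_le)// ler_piMr.
under eq_integral do rewrite EFinD opprD -!mulNr.
rewrite ge0_integralD//.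
by rewrite EFinD leeD//; apply: integral_exp_step_le => //; rewrite mulNr normrN.
Qed.

End OneStep.

(** * Measurability along the trajectory *)

Section Process.
Context (R : realType) (dT : measure_display) (T : measurableType dT).
Variables (P : probability T R) (n : nat) (g : rel 'I_n) (W : probability R R).
Variables (e : nat -> T -> 'I_n * 'I_n) (c : nat -> {RV P >-> bool})
  (w : nat -> {RV P >-> R}).
Hypothesis samples : allocation_samples g W e c w.

Local Notation H t := (g_sigma_algebraType (history_events e c w t)).
Local Notation ld t x := (load (e ^~ x) (c ^~ x) (w ^~ x) t).
Local Notation tw t x := (total_weight (w ^~ x) t).

Let history_sub t := history_events_measurable samples (t := t).

Lemma history_measurable_edge s t a : (s < t)%N ->
  measurable_fun setT (fun x : H t => e s x == a).
Proof.
move=> st; apply: (measurable_fun_bool true); rewrite setTI.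
apply: sub_sigma_algebra; apply: (@history_event _ _ _ _ _ _ _ _ t (inl (inl s))) => //.
by exists [set a] => //; rewrite setTI; apply/seteqP; split => x /= /eqP.
Qed.

Lemma history_measurable_coin s t : measurable_fun setT (c s : H t -> bool).
Proof.
move=> _ B mB; apply: sub_sigma_algebra.
by apply: (@history_event _ _ _ _ _ _ _ _ t (inl (inr s))) => //; exists B.
Qed.

Lemma history_measurable_weight s t : (s < t)%N ->
  measurable_fun setT (w s : H t -> R).
Proof.
move=> st _ B mB; apply: sub_sigma_algebra.
by apply: (@history_event _ _ _ _ _ _ _ _ t (inr s)) => //; exists B.
Qed.

Lemma history_measurable_load s t i : (s <= t)%N ->
  measurable_fun setT (fun x : H t => ld s x i).
Proof.
elim: s i => [|s IH] i st /=; first exact: measurable_cst.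
apply: measurable_funD; first by apply: IH; exact: ltnW.
(* Splitting over the finitely many edge values leaves a fixed edge in each term. *)
rewrite (_ : (fun x => _) = fun x => \sum_a (if e s x == a then
   (if i == pick_bin a (ld s x) (c s x) then w s x else 0) else 0)).
  apply: measurable_sum => a; apply: measurable_fun_ifT => //.
    exact: history_measurable_edge.
  apply: measurable_fun_ifT => //; last exact: history_measurable_weight.
  apply: measurable_pick_bin => [j|]; last exact: history_measurable_coin.
  by apply: IH; exact: ltnW.
apply/funext => x; rewrite -big_mkcond (big_pred1 (e s x)) ?chosen_binE//.
Qed.

Lemma history_measurable_scaled_load alpha s t i : (s <= t)%N ->
  measurable_fun setT (fun x : H t => scaled_load alpha (e ^~ x) (c ^~ x) (w ^~ x) s i).
Proof.
move=> st; apply: measurable_funM => //; apply: measurable_funB.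
  exact: history_measurable_load.
apply: measurable_funM => //; rewrite /total_weight.
apply: measurable_sum => r; apply: history_measurable_weight.
exact: leq_trans (ltn_ord r) st.
Qed.

Lemma measurable_scaled_load alpha t i :
  measurable_fun setT (fun x : T => scaled_load alpha (e ^~ x) (c ^~ x) (w ^~ x) t i).
Proof.
apply: (measurable_fun_g_sigma (G := history_events e c w t)).
  exact: history_sub.
exact: history_measurable_scaled_load.
Qed.

Lemma measurable_cosh_potential d (U : measurableType d) (u : U -> 'I_n -> R) :
  (forall i, measurable_fun setT (u ^~ i)) ->
  measurable_fun setT (fun x => cosh_potential (u x)).
Proof.
move=> mu; apply: measurable_sum => i; apply: measurable_funD.
  exact: measurableT_comp.
by apply: measurableT_comp => //; exact: measurableT_comp.
Qed.

Lemma cosh_potential_ge0 (u : 'I_n -> R) : 0 <= cosh_potential u.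
Proof. by apply: sumr_ge0 => i _; rewrite addr_ge0 ?expR_ge0. Qed.

(** The potential after step [t] if edge [a] were sampled with weight [z.2], as a function of
    history and weight. *)
Definition step_potential alpha t a (z : H t * R) : R :=
  cosh_potential (fun l => scaled_load alpha (e ^~ z.1) (c ^~ z.1) (w ^~ z.1) t l +
    alpha * ((l == pick_bin a (ld t z.1) (c t z.1))%:R - n%:R^-1) * z.2).

Lemma measurable_step_potential alpha t a :
  measurable_fun setT (@step_potential alpha t a).
Proof.
apply: measurable_cosh_potential => l; apply: measurable_funD.
  apply: (measurableT_comp (f := fun x : H t =>
    scaled_load alpha (e ^~ x) (c ^~ x) (w ^~ x) t l)); last exact: measurable_fst.
  exact: history_measurable_scaled_load.
apply: measurable_funM; last exact: measurable_snd.
apply: measurable_funM => //; apply: measurable_funB => //.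
apply: (measurableT_comp (f := fun x : H t =>
  (l == pick_bin a (ld t x) (c t x))%:R : R)); last exact: measurable_fst.
rewrite (_ : (fun x => _) = fun x => if l == pick_bin a (ld t x) (c t x) then 1 else 0).
  apply: measurable_fun_ifT => //.
  apply: measurable_pick_bin => [j|]; last exact: history_measurable_coin.
  exact: history_measurable_load.
by apply/funext => x; case: eqP.
Qed.

(** The events of sampling edge [a] partition the space, and [independent_fubini] treats each of
    them. *)
Lemma expected_next_potential alpha t :
  (\int[P]_x (cosh_potential (scaled_load alpha (e ^~ x) (c ^~ x) (w ^~ x) t.+1))%:E =
   \sum_(a : 'I_n * 'I_n) P (e t @^-1` [set a]) *
      \int[P]_x \int[W]_y (@step_potential alpha t a (x, y))%:E)%E.
Proof.
pose E a := e t @^-1` [set a].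
have UE : \big[setU/set0]_(a <- index_enum ('I_n * 'I_n)%type) E a = setT.
  by apply/seteqP; split => // x _; rewrite -bigcup_seq; exists (e t x) => //=;
    rewrite mem_index_enum.
rewrite -[in LHS]UE ge0_integral_bigsetU//=.
- apply: eq_bigr => a _.
  transitivity (\int[P]_(x in E a) (@step_potential alpha t a (x, w t x))%:E)%E.
    apply: eq_integral => x; rewrite inE => /= xa.
    congr (_%:E); apply: eq_bigr => l _.
    by rewrite !scaled_loadS xa.
  apply: (@independent_fubini _ _ _ P (history_events e c w t) W (w t) (E a) _ _ _
    (fun z => (@step_potential alpha t a z)%:E)).
  + exact: history_sub.
  + exact: edge_measurable samples t a.
  + by move=> A B hA mB; exact: (history_independent samples a hA mB).
  + by apply/measurable_EFinP; exact: measurable_step_potential.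
  + by move=> z; rewrite lee_fin cosh_potential_ge0.
- by move=> a; exact: edge_measurable samples t a.
- exact: index_enum_uniq.
- by move=> a b _ _ [x [/= <- <-]].
- rewrite UE; apply/measurable_EFinP.
  by apply: measurable_cosh_potential => i; exact: measurable_scaled_load.
- by move=> x _; rewrite lee_fin cosh_potential_ge0.
Qed.

End Process.

(** * Drift of the potential *)

Section Expectation.
Context (R : realType) (dT : measure_display) (T : measurableType dT).
Variables (P : probability T R) (n d : nat) (g : rel 'I_n) (W : probability R R).
Variables (e : nat -> T -> 'I_n * 'I_n) (c : nat -> {RV P >-> bool})
  (w : nat -> {RV P >-> R}) (lambda M alpha : R).
Hypothesis samples : allocation_samples g W e c w.
Hypothesis lambda_gt0 : 0 < lambda.
Hypothesis W_ge0 : W `[0, +oo[%classic = 1%E.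
Hypothesis W_mean : (\int[W]_x x%:E = 1)%E.
Hypothesis W_exp : (\int[W]_x (expR (lambda * x))%:E <= M%:E)%E.
Hypotheses (g_simple : simple_graph g) (g_regular : regular_graph d g).
Let phi : R := conductance R d g.
Hypothesis phi_gt0 : 0 < phi.
Let K := 16 * M / lambda ^+ 2.
Hypothesis alpha_bounds : 0 <= alpha <= lambda / 2.
Hypothesis alpha_le1 : alpha <= 1.
Hypothesis K_alpha : 3 * K * alpha <= phi / 8.

Local Notation H t := (g_sigma_algebraType (history_events e c w t)).
Let potential t x := cosh_potential (scaled_load alpha (e ^~ x) (c ^~ x) (w ^~ x) t).

Let measurable_potential t : measurable_fun setT (potential t).
Proof.
apply: measurable_cosh_potential => i.
exact: (measurable_scaled_load samples).
Qed.

Let n_gt1 : (1 < n)%N := conductance_gt0_n phi_gt0.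
Let d_gt0 : (0 < d)%N := conductance_gt0_d phi_gt0.
Let phi_le1 : phi <= 1 := conductance_le1 g_simple g_regular phi_gt0.

Let E := #|edges g|.

Let E_gt0 : 0 < E%:R :> R.
Proof.
have := card_edges R g_simple g_regular; rewrite natrM => H.
have : 0 < n%:R * d%:R :> R by rewrite mulr_gt0 ?ltr0n// ltnW.
by rewrite -H pmulr_rgt0.
Qed.

Let K_ge0 : 0 <= K.
Proof.
have M0 : 0 <= M.
  rewrite -lee_fin; apply: le_trans W_exp; apply: integral_ge0 => x _.
  by rewrite lee_fin expR_ge0.
by rewrite /K divr_ge0 ?sqr_ge0// mulr_ge0.
Qed.

(** With the history fixed, the weight is averaged first by [integral_step_le], then the edge by
    [expected_step_le]. *)
Lemma expected_step_potential_le t x :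
  (\sum_(a : 'I_n * 'I_n) ((a \in edges g)%:R / E%:R)%:E *
      \int[W]_y (step_potential alpha a ((x : H t), y))%:E <=
   ((1 - alpha * phi / (8 * n%:R)) * potential t x + 2 * alpha * phi)%:E)%E.
Proof.
have n_gt0 : (0 < n)%N by exact: ltnW.
have [alpha0 _] := andP alpha_bounds.
pose u := scaled_load alpha (e ^~ x) (c ^~ x) (w ^~ x) t.
pose b a := pick_bin a (load (e ^~ x) (c ^~ x) (w ^~ x) t) (c t x).
have := @expected_step_le R n d g g_simple g_regular phi_gt0 u alpha K b.
rewrite sum_scaled_load// => /(_ erefl alpha0 K_ge0 K_alpha).
move=> /(_ (fun p => pick_bin_endpoint _ _ _)).
have bmin p : u (b p) <= u p.1 /\ u (b p) <= u p.2.
  have [b1 b2] := pick_bin_le p (load (e ^~ x) (c ^~ x) (w ^~ x) t) (c t x).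
  by split; rewrite ler_wpM2l// lerD2r.
move=> /(_ bmin) le_step.
pose S a := \sum_l
  (expR (u l) * (1 + alpha * ((l == b a)%:R - n%:R^-1) +
     K * (alpha * ((l == b a)%:R - n%:R^-1)) ^+ 2) +
   expR (- u l) * (1 + - alpha * ((l == b a)%:R - n%:R^-1) +
     K * (- alpha * ((l == b a)%:R - n%:R^-1)) ^+ 2)).
apply: (@le_trans _ _ (\sum_a ((a \in edges g)%:R / E%:R)%:E * (S a)%:E)%E).
  apply: lee_sum => a _; rewrite lee_wpmul2l ?lee_fin ?divr_ge0//.
  exact: (integral_step_le lambda_gt0 W_ge0 W_mean W_exp n_gt0 u (b a) alpha_bounds).
under eq_bigr do rewrite -EFinM.
rewrite sumEFin lee_fin -(ler_pM2l E_gt0); apply: le_trans le_step.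
rewrite mulr_sumr [leRHS]big_mkcond /=; apply: ler_sum => a _.
case: (a \in edges g); last by rewrite !mul0r mulr0.
by rewrite mul1r mulVKf// gt_eqF.
Qed.

Lemma expected_potential_le t : (\int[P]_x (potential t x)%:E <= (16 * n%:R)%:E)%E.
Proof.
have n_gt0 : 0 < n%:R :> R by rewrite ltr0n ltnW.
have [alpha0 _] := andP alpha_bounds.
have phi0 : 0 <= phi by exact: ltW.
pose q := alpha * phi / (8 * n%:R).
have q0 : 0 <= q by rewrite divr_ge0 ?mulr_ge0.
(* A nonnegative factor [1 - q] is what allows the induction hypothesis to be inserted. *)
have q1 : q <= 1.
  rewrite ler_pdivrMr ?mulr_gt0// mul1r.
  have : 1 <= n%:R :> R by rewrite ler1n ltnW.
  have : alpha * phi <= 1 by rewrite mulr_ile1.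
  lra.
elim: t => [|t IH].
  rewrite (_ : (fun x => _) = cst (2 * n%:R)%:E); last first.
    apply/funext => x; congr (_%:E); rewrite /potential /cosh_potential.
    rewrite (eq_bigr (fun=> 2)); first by rewrite sumr_const card_ord mulr_natr.
    move=> i _; rewrite /scaled_load /total_weight big_ord0 mul0r subrr mulr0.
    by rewrite oppr0 expR0.
  rewrite integral_cst//= probability_setT mule1 lee_fin; lra.
rewrite (expected_next_potential samples).
have mG a : measurable_fun setT (fun x : T =>
    \int[W]_y (step_potential alpha a ((x : H t), y))%:E)%E.
  apply: (measurable_fun_g_sigma (G := history_events e c w t)).
    exact: (history_events_measurable samples).
  apply: (measurable_fun_fubini_tonelli_F (m2 := W)
    (fun z => (step_potential alpha a z)%:E)).
    by apply/measurable_EFinP; exact: measurable_step_potential.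
  by move=> z; rewrite lee_fin cosh_potential_ge0.
have G0 a x : (0 <= \int[W]_y (step_potential alpha a ((x : H t), y))%:E)%E.
  by apply: integral_ge0 => y _; rewrite lee_fin cosh_potential_ge0.
under eq_bigr => a _.
  rewrite (edge_uniform samples) -ge0_integralZl//.
  over.
rewrite -ge0_integral_sum//; last 2 first.
- by move=> a; exact: measurable_funeM.
- by move=> a x _; rewrite mule_ge0// lee_fin divr_ge0.
apply: (@le_trans _ _ (\int[P]_x ((1 - q) * potential t x + 2 * alpha * phi)%:E)%E).
  apply: ge0_le_integral => //.
  - by move=> x _; apply: sume_ge0 => a _; rewrite mule_ge0// lee_fin divr_ge0.
  - by apply: emeasurable_sum => a; exact: measurable_funeM.
  - apply/measurable_EFinP; apply: measurable_funD => //.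
    exact: measurable_funM.
  - by move=> x _; exact: expected_step_potential_le.
under eq_integral do rewrite EFinD EFinM.
have pot0 x : (0 <= (potential t x)%:E)%E by rewrite lee_fin cosh_potential_ge0.
have mpot : measurable_fun setT (fun x => (potential t x)%:E).
  exact/measurable_EFinP.
have q1' : (0 <= (1 - q)%:E)%E by rewrite lee_fin subr_ge0.
rewrite ge0_integralD//; last 3 first.
- by move=> x _; exact: mule_ge0.
- exact: measurable_funeM.
- by move=> x _; rewrite lee_fin !mulr_ge0.
rewrite ge0_integralZl// integral_cst//= probability_setT mule1.
apply: (@le_trans _ _ ((1 - q)%:E * (16 * n%:R)%:E + (2 * alpha * phi)%:E)%E).
  by rewrite leeD2r// lee_wpmul2l.
(* [16 * n] is the fixed point of the recursion, since [q * (16 * n) = 2 * alpha * phi]. *)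
rewrite -EFinM -EFinD lee_fin /q le_eqVlt; apply/orP; left; apply/eqP.
by field; rewrite gt_eqF.
Qed.

End Expectation.

(** * Concentration *)

(** Sorting only permutes the entries; [0 <= L] accounts for the initial value 0 of the maximum. *)
Lemma bigmax_sorted_le (R : realType) (n : nat) (y : 'I_n -> R) (L : R) :
  0 <= L ->
  (\big[Num.max/0]_(i < n) `|(sort >=%R [seq y i | i <- enum 'I_n])`_i| <= L) =
  [forall i, `|y i| <= L].
Proof.
move=> L0; set s := sort _ _.
have sz : size s = n by rewrite size_sort size_map size_enum_ord.
have ms z : (z \in s) = (z \in [seq y i | i <- enum 'I_n]) by rewrite mem_sort.
apply/bigmax_leP/forallP => [[_ Hs] i|Hy].
  have : y i \in s by rewrite ms map_f// mem_enum.
  move=> /(nthP 0)[j]; rewrite sz => jn <-; exact: (Hs (Ordinal jn)).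
split=> // i _.
have : s`_i \in s by rewrite mem_nth// sz.
by rewrite ms => /mapP[j _ ->].
Qed.

Lemma cosh_potential_ge (R : realType) (n : nat) (u : 'I_n -> R) i :
  expR `|u i| <= cosh_potential u.
Proof.
rewrite /cosh_potential (bigD1 i)//= -[leLHS]addr0 lerD//.
  by have [_|_] := ger0P (u i); rewrite ?lerDl ?lerDr expR_ge0.
by apply: sumr_ge0 => j _; rewrite addr_ge0 ?expR_ge0.
Qed.

(** The order of quantifiers makes [k] depend only on [lambda] and the moment bound [M], uniformly
    in [W], the graph and the probability space. *)
Theorem theorem6p2 (R : realType) (lambda M : R) (lambda_gt0 : 0 < lambda) :
  exists k : R, 0 < k /\
  forall W : probability R R,
    W `[0, +oo[%classic = 1%E ->
    (\int[W]_x x%:E = 1)%E ->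
    (\int[W]_x (expR (lambda * x))%:E <= M%:E)%E ->
  forall (n d : nat) (g : rel 'I_n),
    simple_graph g -> connected_graph g -> regular_graph d g ->
    0 < conductance R d g ->
  forall (disp : measure_display) (T : measurableType disp)
    (P : probability T R) (e : nat -> T -> 'I_n * 'I_n)
    (c : nat -> {RV P >-> bool}) (w : nat -> {RV P >-> R}),
    allocation_samples g W e c w ->
  forall m : nat,
    ((1 - n%:R ^- 2)%R%:E <=
     P [set omega | (\big[Num.max/0]_(i < n)
          `|(sorted_normalized_load (e ^~ omega) (c ^~ omega) (w ^~ omega) m)`_i|
        <= k * (d%:R / conductance R d g) * ln n%:R)%R])%E.
Proof.
pose K := 16 * M / lambda ^+ 2.
(* The three terms ensure [alpha <= lambda / 2], [alpha <= 1] and the curvature condition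
   [3 * K * alpha <= phi / 8]. The expression with [K] is kept positive because the sign of [M] is
   unknown before [W] is given. *)
pose kappa := Num.min (Num.min (lambda / 2) 1) (24 * (`|K| + 1))^-1.
have K1_gt0 : 0 < 24 * (`|K| + 1) by rewrite mulr_gt0// ltr_wpDl.
have kappa_gt0 : 0 < kappa by rewrite !lt_min divr_gt0// ltr01 invr_gt0.
have kappa_lambda : kappa <= lambda / 2 by rewrite !ge_min lexx.
have kappa_le1 : kappa <= 1 by rewrite !ge_min lexx orbT.
have kappa_K : 24 * K * kappa <= 1.
  have : kappa * (24 * (`|K| + 1)) <= 1.
    by rewrite -ler_pdivlMr// mul1r !ge_min lexx orbT.
  have := ler_wpM2l (ltW kappa_gt0) (ler_norm K); lra.
(* The 7 comes from [16 * n ^ 3 <= n ^ 7] for [n >= 2], which makes [expR (alpha * L)] reach the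
   Markov level. *)
exists (7 / kappa); split; first by rewrite divr_gt0.
move=> W W_ge0 W_mean W_exp n d g g_simple _ g_regular phi_gt0.
move=> disp T P e c w samples m.
set phi := conductance R d g in phi_gt0 *.
set L := _ * ln n%:R.
have n_gt1 : (1 < n)%N := conductance_gt0_n phi_gt0.
have d_gt0 : (0 < d)%N := conductance_gt0_d phi_gt0.
have phi_le1 : phi <= 1 := conductance_le1 g_simple g_regular phi_gt0.
have n_gt0 : 0 < n%:R :> R by rewrite ltr0n ltnW.
have ln_ge0' : 0 <= ln n%:R :> R by rewrite ln_ge0// ler1n ltnW.
pose alpha := kappa * phi.
have alpha_gt0 : 0 < alpha by rewrite mulr_gt0.
have alpha_kappa : alpha <= kappa by rewrite ler_piMr// ltW.
have L_ge0 : 0 <= L by rewrite !mulr_ge0 ?invr_ge0// ltW.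
have alphaL : alpha * L = 7 * d%:R * ln n%:R.
  by rewrite /alpha /L; field; rewrite !gt_eqF.
have expL : 16 * n%:R ^+ 3 <= expR (alpha * L).
  apply: (@le_trans _ _ (expR (7%:R * ln n%:R))).
    rewrite expRM_natl lnK ?posrE// (exprD _ 4 3).
    apply: ler_wpM2r; first by rewrite exprn_ge0.
    have -> : 16 = 2 ^+ 4 :> R by ring.
    by rewrite lerXn2r ?nnegrE// ler_nat.
  by rewrite ler_expR alphaL ler_wpM2r// ler_peMr// ler1n.
pose u t x := scaled_load alpha (e ^~ x) (c ^~ x) (w ^~ x) t.
have mu i : measurable_fun setT (fun x => u m x i).
  exact: (measurable_scaled_load samples).
have EG : (\int[P]_x (cosh_potential (u m x))%:E <= (16 * n%:R)%:E)%E.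
  apply: (expected_potential_le samples lambda_gt0 W_ge0 W_mean W_exp
    g_simple g_regular phi_gt0).
  - by rewrite ltW//= (le_trans alpha_kappa).
  - exact: le_trans kappa_le1.
  - have := ler_wpM2r (ltW phi_gt0) kappa_K; rewrite /alpha -/K -/phi; lra.
set A := [set omega | _].
have AE : A = \bigcap_(i in [set: 'I_n]) [set x | `|u m x i| <= alpha * L].
  apply/seteqP; split => x /=; rewrite /A /= bigmax_sorted_le//.
    move=> /forallP Hx i _ /=.
    by rewrite /u /scaled_load normrM gtr0_norm// ler_wpM2l ?Hx// ltW.
  move=> Hx; apply/forallP => i; have := Hx i Logic.I => /=.
  by rewrite /u /scaled_load normrM gtr0_norm// ler_pM2l.
have mA : measurable A.
  rewrite AE; apply: fin_bigcap_measurable => [|i _]; first exact: finite_finset.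
  rewrite -[X in measurable X]setTI.
  have : measurable_fun setT (fun x => `|u m x i|) by exact: measurableT_comp.
  move=> /(_ measurableT _ (measurable_itv `]-oo, (alpha * L)])).
  by congr (measurable _); apply/seteqP; split => x /=; rewrite in_itv.
have mG : measurable_fun setT (fun x => (cosh_potential (u m x))%:E).
  by apply/measurable_EFinP; exact: measurable_cosh_potential.
have c_gt0 : 0 < 16 * n%:R ^+ 3 :> R by rewrite mulr_gt0// exprn_gt0.
(* Markov's inequality for the potential at level [16 * n ^ 3]. *)
have := le_integral_abse P measurableT mG c_gt0.
rewrite setTI; set B := [set x | _] => markov.
have mB : measurable B.
  have /measurable_EFinP := mG.
  move=> /(_ measurableT _ (measurable_itv `[(16 * n%:R ^+ 3)%R, +oo[)).
  rewrite setTI; congr (measurable _); apply/seteqP; split => x /=;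
    by rewrite /B /= in_itv /= andbT lee_fin ger0_norm ?cosh_potential_ge0.
(* A single bin with scaled load beyond [alpha * L] already pushes the potential above the level. *)
have AB : ~` A `<=` B.
  move=> x; rewrite AE setC_bigcap => -[i _ /= /negP]; rewrite -ltNge => ui.
  rewrite /B /= lee_fin ger0_norm ?cosh_potential_ge0//.
  apply: (le_trans expL); apply: le_trans (cosh_potential_ge _ i).
  by rewrite ler_expR ltW.
have PB : (P B <= (n%:R ^- 2)%:E)%E.
  have : ((16 * n%:R ^+ 3)%:E * P B <= (16 * n%:R)%:E)%E.
    apply: (le_trans markov); apply: le_trans EG; rewrite le_eqVlt; apply/orP; left.
    by apply/eqP/eq_integral => x _; rewrite /= ger0_norm ?cosh_potential_ge0.
  have PB_fin : P B \is a fin_num by exact: fin_num_measure.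
  rewrite -(fineK PB_fin) -EFinM !lee_fin => le16.
  rewrite -(ler_pM2l c_gt0); apply: (le_trans le16).
  rewrite le_eqVlt; apply/orP; left; apply/eqP.
  by field; rewrite gt_eqF.
have PA := probability_setC P (measurableC mA).
rewrite setCK in PA; rewrite PA EFinB leeB//.
apply: le_trans PB; apply: le_measure; rewrite ?inE//.
exact: measurableC.
Qed.
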